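(* Let $Y_1$ and $Y_2$ be independent positive random variables. Suppose that $\mathbb{P}(Y_1>u)>0$ for all $u$ and that there is a positive function $a(\cdot)$, regularly varying at infinity with index $-\tau$ for some $\tau\ge -1$ (i.e. $\lim_{u\to\infty}a(ux)/a(u)=x^{-\tau}$ for all $x>0$), such that $$\lim_{u\to\infty}\frac{\mathbb{P}(Y_1>u+a(u)t)}{\mathbb{P}(Y_1>u)}=\exp(-t)\quad\text{for all } t\ge 0.$$ Suppose further that the distribution of $Y_2$ has right endpoint equal to $1$. Then $X=Y_1Y_2$ satisfies $$\lim_{u\to\infty}\frac{\mathbb{P}(X>u+a(u)t)}{\mathbb{P}(X>u)}=\exp(-t)\quad\text{for all } t\ge 0,$$ i.e. $X$ belongs to the Gumbel max-domain of attraction with the same scaling function $a$.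
   Context: A random variable $U$ is said to be in the Gumbel max-domain of attraction with scaling function $a$ (written $U\in GMDA(a)$) if $\lim_{u\to\infty}\mathbb{P}(U>u+a(u)t)/\mathbb{P}(U>u)=\exp(-t)$ for all $t\ge 0$. *)

(* Defs.v *)
From HB Require Import structures.
From mathcomp Require Import all_boot all_order all_algebra.
From mathcomp Require Import all_classical all_reals all_analysis.
Set Implicit Arguments. Unset Strict Implicit. Unset Printing Implicit Defensive.
Import Order.TTheory GRing.Theory Num.Theory.
Import numFieldNormedType.Exports.
Local Open Scope classical_set_scope.
Local Open Scope ring_scope.

Definition tailP d (T : measurableType d) (R : realType)
  (P : probability T R) (X : T -> R) (u : R) : R :=
  fine (P [set w | u < X w]).

Definition gumbel_mda d (T : measurableType d) (R : realType)
  (P : probability T R) (X : T -> R) (a : R -> R) : Prop :=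
  forall t : R, 0 <= t ->
    (tailP P X (u + a u * t) / tailP P X u) @[u --> +oo] --> expR (- t).

Definition indep2 d (T : measurableType d) (R : realType)
  (P : probability T R) (X Y : T -> R) : Prop :=
  forall A B : set R, measurable A -> measurable B ->
    P (X @^-1` A `&` Y @^-1` B) = (P (X @^-1` A) * P (Y @^-1` B))%E.

Definition right_endpoint d (T : measurableType d) (R : realType)
  (P : probability T R) (X : T -> R) : \bar R :=
  ereal_sup [set x%:E | x in [set x : R | (0 < P [set w | (x < X w)%R])%E]].

(* Main.v *)
Require Import Defs.
From HB Require Import structures.
From mathcomp Require Import all_boot all_order all_algebra.
From mathcomp Require Import all_classical all_reals all_analysis.
From mathcomp Require Import measurable_realfun ring lra.
Import Order.TTheory GRing.Theory Num.Theory.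
Import numFieldNormedType.Exports.
Local Open Scope classical_set_scope.
Local Open Scope ring_scope.

(** The tail [F] of [Y1] and the auxiliary function [a] are linked by the
    monotone function [efold u = inf {x | F x <= F u / e}]: the Gumbel condition
    gives [efold u - u ~ a u]. Hence [a] is asymptotic to a measurable function,
    so that its regular variation is locally uniform although [a] itself need
    not be measurable. Moreover [a u = o(u)], so [F (l u) = o(F u)] for [l > 1].
    Since [F] is rapidly varying, [{X > u}] is asymptotically carried by
    [{Y2 > 1 - delta}]; there [F ((u + a u t) / y) ~ exp (- t) F (u / y)]
    uniformly in [y], and integrating over the law of [Y2] concludes. *)

(** * Uniform convergence for slowly varying functions *)

Lemma lebesgue_measure_translate (R : realType) (c : R) (A : set R) :
  measurable A ->
  pushforward lebesgue_measure (+%R c : _ -> measurableTypeR R) A =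
  lebesgue_measure A.
Proof.
move=> mA; apply/esym/lebesgue_measure_unique => //=.
  exact: (@measurable_funD _ (measurableTypeR R)).
move=> _ _ [[a b]] _ <-.
rewrite /pushforward /=.
have -> : +%R c @^-1` `]a, b]%classic = `]a - c, b - c]%classic.
  apply/seteqP; split => x; rewrite /= !in_itv/=;
  by rewrite ltrBlDl lerBrDl.
rewrite !lebesgue_measure_itv/= !lte_fin ltrD2r.
by case: ifP => // _; rewrite -!EFinD; congr EFin; ring.
Qed.

Section uniform_convergence.
Context {R : realType}.
Notation mu := (@lebesgue_measure R).
Variable g : R -> R.
Hypothesis mg : measurable_fun [set: R] g.
Hypothesis g_slow : forall s, g (x + s) - g x @[x --> +oo] --> 0.

(** Requiring the bound for all later indices makes these sets increase with [n]. The window has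
    length 2 so that, after a translation by at most 1, two such sets still lie in an interval of
    length 3. *)
Let small (e : R) (x : nat -> R) (n : nat) : set R :=
  `[0, 2] `&` \bigcap_(k in [set k | (n <= k)%N])
     [set s | `|g (x k + s) - g (x k)| < e].

Let measurable_small e x n : measurable (small e x n).
Proof.
apply: measurableI => //; apply: bigcap_measurableType => k _.
rewrite -[X in measurable X]setTI.
have mf : measurable_fun [set: R] (fun s => `|g (x k + s) - g (x k)|).
  apply: measurableT_comp => //; apply: measurable_funB => //.
  by apply: measurableT_comp => //; exact: measurable_funD.
have := mf measurableT `]-oo, e[%classic (measurable_itv _).
by congr measurable; apply/seteqP; split => s /=; rewrite in_itv.
Qed.

(** Pointwise slow variation puts every shift of [[0, 2]] in some set of the increasing sequence, so
    continuity from below gives measures tending to 2. The level 3/2 is half the length of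
    [[0, 3]]. *)
Let small_large e x : 0 < e -> (forall n, n%:R <= x n) ->
  \forall n \near \oo, ((3 / 2)%:E < mu (small e x n))%E.
Proof.
move=> e0 xn.
have cupE : \bigcup_n small e x n = `[0, 2]%classic.
  apply/seteqP; split => [s [n _ []]//|s s02].
  have /cvgrPdist_lt /(_ _ e0) [M [_ HM]] := g_slow s.
  exists (Num.truncn `|M|).+1 => //; split => // k /= Mk.
  have := HM (x k); rewrite sub0r normrN; apply.
  apply: lt_le_trans (xn k); apply: le_lt_trans (ler_norm M) _.
  by apply: lt_le_trans (truncnS_gt _) _; rewrite ler_nat.
have : mu \o small e x @ \oo --> mu `[0, 2]%classic.
  rewrite -cupE; apply: nondecreasing_cvg_mu => [n||n m nm].
  - exact: measurable_small.
  - by rewrite cupE.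
  - apply/subsetPset => s [s02 Hs]; split => // k /= mk; apply: Hs => /=.
    exact: leq_trans mk.
rewrite lebesgue_measure_itv/= lte_fin ltr0n/= sube0.
have lt32 : ((3 / 2)%:E < 2%:E :> \bar R)%E by rewrite lte_fin; lra.
by move=> /(_ _ (open_ereal_gt' lt32)).
Qed.

(* Csiszar and Erdos: if uniformity fails along [x_n] and [x_n + s_n], the two
   sets of shifts along which [g] is almost constant from [x_n] and from
   [x_n + s_n] are both large, hence they have a common endpoint. *)
Lemma uniform_slow_variation (e : R) : 0 < e ->
  \forall x \near +oo, forall s, 0 <= s <= 1 -> `|g (x + s) - g x| < e.
Proof.
move=> e0; apply: contrapT => nu.
have bad n : exists p : R * R,
    [/\ n%:R <= p.1, 0 <= p.2 <= 1 & e <= `|g (p.1 + p.2) - g p.1|].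
  apply: contrapT => nex; apply: nu.
  exists n%:R; split; first exact: num_real.
  move=> x nx s s01; rewrite ltNge; apply/negP => ge.
  by apply: nex; exists (x, s); split => //; exact: ltW.
have [f fP] := choice bad.
pose x n := (f n).1; pose s n := (f n).2.
have e20 : 0 < e / 2 by rewrite divr_gt0.
have xn n : n%:R <= x n by have [] := fP n.
have yn n : n%:R <= x n + s n.
  have [H /andP[s0 _] _] := fP n.
  by rewrite -[n%:R]addr0 lerD.
near \oo => n.
have An : ((3 / 2)%:E < mu (small (e / 2) x n))%E.
  by near: n; exact: small_large.
have Bn : ((3 / 2)%:E < mu (small (e / 2) (fun n => (x n + s n)%R) n))%E.
  by near: n; exact: small_large.
set A := small _ _ _ in An; set B := small _ _ _ in Bn.
have [_ /andP[s0 s1] bd] := fP n.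
(* [C] is [B] translated by [s n]: a shift of [B] from [x n + s n] becomes a shift from [x n] with
   the same endpoint. *)
pose C := (fun z : R => - s n + z) @^-1` B.
have mC : measurable C.
  rewrite -[C]setTI.
  have : measurable_fun [set: R] (fun z : R => - s n + z).
    exact: measurable_funD.
  by apply => //; exact: measurable_small.
have muC : mu C = mu B.
  exact: (@lebesgue_measure_translate R (- s n) B (measurable_small _ _ _)).
have AC0 : A `&` C = set0.
  rewrite -subset0 => z [[_ Az] [_ Cz]].
  have /= Azn := Az n (leqnn n); have /= Czn := Cz n (leqnn n).
  move: bd; rewrite leNgt => /negP; apply.
  have -> : g ((f n).1 + (f n).2) - g (f n).1 =
      (g (x n + z) - g (x n)) - (g (x n + s n + (- s n + z)) - g (x n + s n)).
    have -> : x n + s n + (- s n + z) = x n + z by ring.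
    by rewrite /x /s; ring.
  by apply: le_lt_trans (ler_normB _ _) _; lra.
(* Disjoint sets of measure above 3/2 each cannot both fit in [[0, 3]]. *)
have : (mu (A `|` C) <= mu `[0%R, 3%R]%classic)%E.
  apply: le_measure; rewrite ?inE//.
    by apply: measurableU => //; exact: measurable_small.
  move=> z [[] /=|[] /=]; rewrite !in_itv/= /s => /andP[z0 z1] _;
  by apply/andP; lra.
rewrite measureU//; last exact: measurable_small.
rewrite lebesgue_measure_itv/= lte_fin ltr0n/= sube0.
rewrite muC leNgt => /negP; apply.
have -> : (3%:E = (3 / 2)%:E + (3 / 2)%:E :> \bar R)%E.
  by rewrite -EFinD; congr EFin; lra.
exact: lteD.
Unshelve. all: by end_near. Qed.
End uniform_convergence.

(** * Tails with a Gumbel limit *)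

Section gumbel_tail.
Context {R : realType}.
Variables F a : R -> R.
Hypothesis F_noninc : {homo F : x y / x <= y >-> y <= x}.
Hypothesis F_gt0 : forall u, 0 < F u.
Hypothesis F_cvg0 : F x @[x --> +oo] --> 0.
Hypothesis a_gt0 : forall u, 0 < a u.
Hypothesis F_gumbel : forall t, 0 <= t ->
  F (u + a u * t) / F u @[u --> +oo] --> expR (- t).

Lemma gumbel_gt (t k : R) : 0 <= t -> k < expR (- t) ->
  \forall u \near +oo, k * F u < F (u + a u * t).
Proof.
move=> t0 kt; near=> u; rewrite -ltr_pdivlMr//.
by near: u; exact: cvgr_gt (F_gumbel _ t0) _ kt.
Unshelve. all: by end_near. Qed.

Lemma gumbel_lt (t k : R) : 0 <= t -> expR (- t) < k ->
  \forall u \near +oo, F (u + a u * t) < k * F u.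
Proof.
move=> t0 kt; near=> u; rewrite -ltr_pdivrMr//.
by near: u; exact: cvgr_lt (F_gumbel _ t0) _ kt.
Unshelve. all: by end_near. Qed.

(** * The monotone substitute for the scale function *)

Definition efold (u : R) : R := inf [set x | F x <= expR (-1) * F u].

Let efold_lb u : lbound [set x | F x <= expR (-1) * F u] u.
Proof.
move=> x /= Fx; rewrite leNgt; apply/negP => /ltW/F_noninc ux.
have : expR (-1) * F u < F u by rewrite gtr_pMl// expR_lt1; lra.
by lra.
Qed.

Let efold_neq0 u : [set x | F x <= expR (-1) * F u] !=set0.
Proof.
have e0 : 0 < expR (-1) * F u by rewrite mulr_gt0 ?expR_gt0.
near (pinfty_nbhs R) => x; exists x => /=; apply: ltW.
by near: x; exact: cvgr_lt _ F_cvg0 _ e0.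
Unshelve. all: by end_near. Qed.

Lemma efold_le u x : F x <= expR (-1) * F u -> efold u <= x.
Proof. by move=> Fx; apply: ge_inf => //; exists u. Qed.

Lemma le_efold u x : expR (-1) * F u < F x -> x <= efold u.
Proof.
move=> Fx; apply: lb_le_inf => // y /= Fy.
by rewrite leNgt; apply/negP => /ltW/F_noninc; lra.
Qed.

Lemma efold_nd : nondecreasing_fun efold.
Proof.
move=> u v uv; apply: lb_le_inf => // x /= Fx; apply: efold_le.
by apply: le_trans Fx _; rewrite ler_pM2l ?expR_gt0// F_noninc.
Qed.

(** The Gumbel limits at [t = 1 - e] and [t = 1 + e] lie strictly on either side of [expR (-1)]. *)
Lemma efold_near (e : R) : 0 < e < 1 -> \forall u \near +oo,
  a u * (1 - e) <= efold u - u <= a u * (1 + e).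
Proof.
move=> /andP[e0 e1]; near=> u; apply/andP; split.
  rewrite lerBrDl; apply: le_efold; near: u; apply: gumbel_gt; first by lra.
  by rewrite ltr_expR; lra.
rewrite lerBlDl; apply: efold_le; apply: ltW; near: u.
by apply: gumbel_lt; rewrite ?ltr_expR; lra.
Unshelve. all: by end_near. Qed.

Lemma efold_ratio_cvg : (efold u - u) / a u @[u --> +oo] --> (1 : R).
Proof.
apply/cvgrPdist_le => e e0.
have h : 0 < Num.min e (1 / 2) < 1.
  rewrite lt_min gt_min; apply/andP.
  by split; [apply/andP; split|apply/orP; right]; lra.
near=> u.
have /andP[h1 h2] : a u * (1 - Num.min e (1 / 2)) <= efold u - u <=
    a u * (1 + Num.min e (1 / 2)).
  by near: u; exact: efold_near.
have me : Num.min e (1 / 2) <= e by rewrite ge_min lexx.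
rewrite mulrC -ler_pdivlMr ?a_gt0// in h1.
rewrite mulrC -ler_pdivrMr ?a_gt0// in h2.
by rewrite ler_norml; apply/andP; split; lra.
Unshelve. all: by end_near. Qed.

(* Along the orbit [w n.+1 = w n + a (w n)] the scale [a] grows at most by the
   factor [1 + 3 d] per step, so [a (w n) <= a (w 0) + 3 d (w n - w 0)]. Between
   two points of the orbit [a] is controlled by the monotonicity of [efold]. *)
Lemma gumbel_scale_small (e : R) : 0 < e -> \forall u \near +oo, a u <= e * u.
Proof.
wlog e3 : e / e <= 1 / 3.
  move=> H e0; have [/H/(_ e0)//|e3] := leP e (1 / 3).
  have h3 : (0 : R) < 1 / 3 by lra.
  have := H _ (lexx (1 / 3)) h3.
  move=> H3; near=> u.
  have : a u <= 1 / 3 * u by near: u.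
  have u0 : 0 <= u by [].
  by nra.
move=> e0.
(* The end of the proof uses [a u <= 6 * a (w m)]. The slope [3 * d] then contributes
   [18 * d * u = e / 2 * u], and the constant term, at most [e / 12 * u], contributes the other
   half. *)
pose d := e / 36.
have d0 : 0 < d by rewrite divr_gt0.
have d1 : d <= 1 / 3 by rewrite /d; lra.
have dh : 0 < d < 1 by apply/andP; split; lra.
have : \forall u \near +oo, [/\ a u * (1 - d) <= efold u - u,
    efold (u + a u) <= u + a u + a u * (1 + d),
    F (u + a u) <= expR (- (1 / 2)) * F u & 0 < u].
  near=> u; split => //.
  - suff /andP[] : a u * (1 - d) <= efold u - u <= a u * (1 + d) by [].
    by near: u; exact: efold_near.
  (* Both tails are compared with [F u], at [t = 1] and [t = 2 + d]. This bounds [efold] at the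
     shifted point without comparing [a] at two points. *)
  - have h1 : expR (- (1 + d / 2)) * F u < F (u + a u * 1).
      near: u; apply: gumbel_gt => //.
      by rewrite ltr_expR; lra.
    have h2 : F (u + a u * (2 + d)) < expR (- (2 + d / 2)) * F u.
      by near: u; apply: gumbel_lt; rewrite ?ltr_expR; lra.
    rewrite mulr1 in h1.
    have -> : u + a u + a u * (1 + d) = u + a u * (2 + d) by ring.
    apply: efold_le; apply: le_trans (ltW h2) _.
    have -> : - (2 + d / 2) = - 1 + - (1 + d / 2) by ring.
    by rewrite expRD -mulrA ler_pM2l ?expR_gt0// ltW.
  - rewrite -{1}[a u]mulr1; apply: ltW; near: u; apply: gumbel_lt => //.
    by rewrite ltr_expR; lra.
move=> [M [_ HM]].
pose w n := iter n (fun u => u + a u) (M + 1).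
have wS n : w n.+1 = w n + a (w n) by [].
have wM n : M + 1 <= w n.
  elim: n => [|n ih]; first by rewrite lexx.
  by rewrite wS (le_trans ih)// lerDl ltW.
have wM' n : M < w n by apply: lt_le_trans (wM n); lra.
have aw n : a (w n) <= a (M + 1) + 3 * d * (w n - (M + 1)).
  elim: n => [|n ih]; first by rewrite subrr mulr0 addr0.
  have [_ h2 _ _] := HM _ (wM' n).
  have [h1 _ _ _] := HM _ (wM' n.+1).
  rewrite wS in h1 *.
  have an := a_gt0 (w n); have an1 := a_gt0 (w n + a (w n)).
  (* For [d <= 1 / 3], [1 + d <= (1 + 3 * d) * (1 - d)], which yields the growth factor. *)
  have : a (w n + a (w n)) * (1 - d) <= a (w n) * (1 + d) by lra.
  have dd : 0 <= d * (1 - 3 * d) by rewrite mulr_ge0//; lra.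
  move=> h3; suff : a (w n + a (w n)) <= a (w n) * (1 + 3 * d) by lra.
  have d1' : 0 < 1 - d by lra.
  rewrite -(ler_pM2r d1'); apply: le_trans h3 _.
  by rewrite -mulrA ler_pM2l//; lra.
have Fw n : F (w n) <= expR (- (1 / 2)) ^+ n * F (M + 1).
  elim: n => [|n ih]; first by rewrite expr0 mul1r.
  have [_ _ h _] := HM _ (wM' n).
  rewrite wS (le_trans h)// exprS -mulrA ler_pM2l ?expR_gt0//.
(* [F] decays geometrically along the orbit; a bounded orbit would keep it above a positive
   value. *)
have wub u : exists n, u < w n.
  have [n Hn] : exists n, expR (- (1 / 2)) ^+ n * F (M + 1) < F u.
    have : expR (- (1 / 2)) ^+ n @[n --> \oo] --> (0 : R).
      by apply: cvg_expr; rewrite ger0_norm ?expR_ge0// expR_lt1; lra.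
    have FM : 0 < F u / F (M + 1) by rewrite divr_gt0.
    move=> /(cvgr_lt _)/(_ _ FM)[n _ Hn]; exists n.
    by rewrite -ltr_pdivlMr//; apply: Hn => /=.
  exists n; rewrite ltNge; apply/negP => /F_noninc.
  by have := Fw n; lra.
near=> u.
have uM : M + 1 <= u by [].
case: (ex_minnP (wub u)) => -[|m] um minm; first by move: um; rewrite /w/=; lra.
have mu : w m <= u.
  by rewrite leNgt; apply/negP => /minm; rewrite ltnn.
have [h1 _ _ _] : [/\ a u * (1 - d) <= efold u - u,
    efold (u + a u) <= u + a u + a u * (1 + d),
    F (u + a u) <= expR (- (1 / 2)) * F u & 0 < u] by apply: HM; lra.
have [_ h2 _ w0] := HM _ (wM' m).
have h3 := efold_nd _ _ (ltW um).
have am := aw m.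
rewrite wS in h3.
have am0 := a_gt0 (w m); have au0 := a_gt0 u.
(* Since [w m <= u < w m.+1], monotonicity of [efold] gives [a u * (1 - d) <= a (w m) * (2 + d)]. *)
have h4 : a u <= 6 * a (w m).
  have aud : a u * d <= a u * (1 / 3) by rewrite ler_pM2l.
  have amd : a (w m) * d <= a (w m) * (1 / 3) by rewrite ler_pM2l.
  by lra.
have M0 : a (M + 1) - 3 * d * (M + 1) <= e / 12 * u.
  have : (a (M + 1) - 3 * d * (M + 1)) / (e / 12) <= u.
    by near: u; apply: nbhs_pinfty_ge; exact: num_real.
  by rewrite ler_pdivrMr ?divr_gt0// [u * _]mulrC.
have : 3 * d * w m <= 3 * d * u by rewrite ler_pM2l//; lra.
by rewrite /d in am M0 *; nra.
Unshelve. all: by end_near. Qed.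

(** As [a] is sublinear, [u * l] eventually lies beyond [u + a u / e], where the tail ratio has
    limit [expR (- e^-1) < e]. *)
Lemma gumbel_rapid (l e : R) : 1 < l -> 0 < e ->
  \forall u \near +oo, F (u * l) <= e * F u.
Proof.
move=> l1 e0.
have ei0 : 0 < e^-1 by rewrite invr_gt0.
have ht : expR (- e^-1) < e.
  rewrite expRN -[ltRHS]invrK ltf_pV2 ?posrE ?expR_gt0 ?invr_gt0//.
  by apply: lt_le_trans (expR_ge1Dx _); rewrite ltrDr.
have c0 : 0 < (l - 1) * e by rewrite mulr_gt0// subr_gt0.
near=> u.
apply: (@le_trans _ _ (F (u + a u * e^-1))).
  apply: F_noninc.
  suff : a u * e^-1 <= (l - 1) * u by lra.
  rewrite ler_pdivrMr// mulrAC.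
  by near: u; exact: gumbel_scale_small.
by apply: ltW; near: u; apply: gumbel_lt => //; exact: ltW.
Unshelve. all: by end_near. Qed.

(** * Local uniformity from regular variation of the scale *)

Variable tau : R.
Hypothesis a_rv : forall x, 0 < x ->
  a (u * x) / a u @[u --> +oo] --> x `^ (- tau).

Let expR_cvgy : expR (x : R) @[x --> +oo] --> +oo.
Proof.
apply/cvgryPge => A; near=> x; apply: le_trans (expR_ge1Dx _).
have : A <= x by [].
lra.
Unshelve. all: by end_near. Qed.

(** In the variable [x = ln u], regular variation becomes additive. The term [tau * x] cancels the
    index, and [efold u - u] replaces [a u] to gain measurability. *)
Let log_scale x := ln (efold (expR x) - expR x) + tau * x.

Let measurable_log_scale : measurable_fun [set: R] log_scale.
Proof.
have mb : measurable_fun [set: R] (fun x => efold (expR x) - expR x).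
  apply: measurable_funB => //; apply: (measurableT_comp (f := efold)) => //.
  exact: nondecreasing_measurable efold_nd.
apply: measurable_funD; first exact: measurableT_comp.
exact: measurable_funM.
Qed.

Let log_ratio_cvg0 : ln (efold u - u) - ln (a u) @[u --> +oo] --> (0 : R).
Proof.
have : ln ((efold u - u) / a u) @[u --> +oo] --> ln (1 : R).
  exact: cvg_comp efold_ratio_cvg (continuous_ln ltr01).
rewrite ln1; apply: cvg_trans; apply: near_eq_cvg; near=> u.
rewrite ln_div ?posrE//.
(* Splitting the logarithm of the quotient requires [efold u - u] to be positive. *)
suff /andP[h _] : a u * (1 - 1 / 2) <= efold u - u <= a u * (1 + 1 / 2).
  by apply: lt_le_trans h; rewrite mulr_gt0//; lra.
by near: u; apply: efold_near; apply/andP; split; lra.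
Unshelve. all: by end_near. Qed.

Let log_scale_slow s : log_scale (x + s) - log_scale x @[x --> +oo] --> (0 : R).
Proof.
have rv : ln (a (u * expR s) / a u) @[u --> +oo] --> - tau * s.
  rewrite -{2}[s]expRK -ln_powR.
  apply: cvg_comp (a_rv _ (expR_gt0 s)) (continuous_ln _).
  by rewrite powR_gt0 ?expR_gt0.
have shift : expR (x + s) @[x --> +oo] --> +oo.
  exact: (cvg_comp _ _ (cvg_addrr s) expR_cvgy).
pose h u := ln (efold u - u) - ln (a u).
have c1 : h (expR (x + s)) @[x --> +oo] --> (0 : R).
  exact: (cvg_comp _ _ shift log_ratio_cvg0).
have c2 : h (expR x) @[x --> +oo] --> (0 : R).
  exact: (cvg_comp _ _ expR_cvgy log_ratio_cvg0).
have c3 : ln (a (expR x * expR s) / a (expR x)) @[x --> +oo] --> - tau * s.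
  exact: (cvg_comp _ _ expR_cvgy rv).
have -> : (0 : R) = 0 - 0 + (- tau * s + tau * s) by ring.
rewrite (_ : (fun x => log_scale (x + s) - log_scale x) = (fun x =>
    h (expR (x + s)) - h (expR x) +
    (ln (a (expR x * expR s) / a (expR x)) + tau * s))).
  by apply: cvgD; [exact: cvgB|apply: cvgD => //; exact: cvg_cst].
apply/funext => x; rewrite /log_scale /h ln_div ?posrE// -expRD.
ring.
Qed.

(** One third of [e] pays for the uniform convergence of [log_scale], the other two for returning
    from [efold] to [a] at [u] and at [u * expR s]. *)
Lemma gumbel_scale_uniform (e : R) : 0 < e -> \forall u \near +oo,
  forall s, 0 <= s <= 1 -> `|ln (a (u * expR s)) - ln (a u) + tau * s| < e.
Proof.
move=> e0; have e20 : 0 < e / 3 by rewrite divr_gt0.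
have [M1 [_ H1]] :=
  uniform_slow_variation _ measurable_log_scale log_scale_slow _ e20.
have /cvgrPdist_lt/(_ _ e20)[M2 [_ H2]] := log_ratio_cvg0.
near=> u => s s01.
have u0 : 0 < u by [].
have us : u <= u * expR s.
  by rewrite ler_peMr ?(ltW u0)//; apply: le_trans (expR_ge1Dx _); lra.
have h1 : M1 < ln u by rewrite -ltr_expR lnK ?posrE.
have uM2 : M2 < u by near: u; apply: nbhs_pinfty_gt; exact: num_real.
have := H1 _ h1 _ s01; rewrite /log_scale expRD lnK ?posrE//.
have := H2 _ uM2; have := H2 _ (lt_le_trans uM2 us).
rewrite !sub0r !normrN => /=.
set p := ln (efold _ - _); set q := ln (a (u * _)).
set p' := ln (efold u - u); set q' := ln (a u).
move=> h2 h3 h4.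
have -> : q - q' + tau * s =
    (p + tau * (ln u + s) - (p' + tau * ln u)) - ((p - q) - (p' - q')) by ring.
apply: le_lt_trans (ler_normB _ _) _.
have := ler_normB (p - q) (p' - q'); lra.
Unshelve. all: by end_near. Qed.

(** With [v = u / y], the point [(u + a u * t) / y] equals [v + a v * (t * expR q)] with [q]
    uniformly small. Monotonicity of [F] then reduces the claim to two fixed values of [t] at the
    single point [v]. *)
Lemma gumbel_uniform (t e : R) : 0 <= t -> 0 < e -> exists2 d : R, 0 < d < 1 &
  \forall u \near +oo, forall y, 1 - d <= y <= 1 ->
    (expR (- t) - e) * F (u / y) <= F ((u + a u * t) / y) <=
    (expR (- t) + e) * F (u / y).
Proof.
move=> t0 e0.
have [r /andP[r0 r1] [rl ru]] : exists2 r : R, 0 < r < 1 &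
    expR (- t) - e < expR (- (t * expR r)) /\
    expR (- (t * expR (- r))) < expR (- t) + e.
  have cvge : expR (- (t * expR x)) @[x --> (0 : R)] --> expR (- t).
    rewrite -[t in expR (- t)]mulr1 -(@expR0 R).
    apply: continuous_cvg; first exact: continuous_expR.
    apply: cvgN; apply: cvgM; first exact: cvg_cst.
    exact: continuous_expR.
  have /cvgrPdist_lt/(_ _ e0)/nbhs_norm0P[r /= r0 Hr] := cvge.
  exists (Num.min (r / 2) (1 / 2)).
    rewrite lt_min gt_min; apply/andP.
    by split; [apply/andP; split|apply/orP; right]; lra.
  set r' := Num.min _ _.
  have r'0 : 0 < r' by rewrite lt_min; apply/andP; split; lra.
  have r'r : r' < r by rewrite gt_min; apply/orP; left; lra.
  have h1 : `|expR (- t) - expR (- (t * expR r'))| < e.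
    by apply: Hr => /=; rewrite gtr0_norm.
  have h2 : `|expR (- t) - expR (- (t * expR (- r')))| < e.
    by apply: Hr => /=; rewrite normrN gtr0_norm.
  by move: h1 h2; rewrite !ltr_norml => /andP[? ?] /andP[? ?]; split; lra.
(* For [y = expR (- s)] and [s <= r / K], the drift [(1 + tau) * s] in [q] is at most [r / 2]; the
   other half is left to the uniform error. Also [K >= 2] keeps [s] in [[0, 1]]. *)
pose K := 2 * (1 + `|tau|).
have K0 : 2 <= K by rewrite /K; have := normr_ge0 tau; lra.
pose s0 := r / K.
have s00 : 0 < s0 by rewrite divr_gt0//; lra.
have s01 : s0 <= 1 by rewrite ler_pdivrMr; lra.
have r20 : 0 < r / 2 by rewrite divr_gt0.
exists (1 - expR (- s0)).
  rewrite subr_gt0 expR_lt1 oppr_lt0 s00/= gtrBl; exact: expR_gt0.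
have [M1 [_ H1]] : \forall v \near +oo,
    (expR (- t) - e) * F v < F (v + a v * (t * expR r)) /\
    F (v + a v * (t * expR (- r))) < (expR (- t) + e) * F v.
  near=> v; split; near: v.
    by apply: gumbel_gt => //; rewrite mulr_ge0// expR_ge0.
  by apply: gumbel_lt => //; rewrite mulr_ge0// expR_ge0.
near=> u => y; rewrite subKr => /andP[y0 y1].
have u0 : 0 < u by [].
have yp : 0 < y by apply: lt_le_trans y0; exact: expR_gt0.
have ys : y = expR (- (- ln y)) by rewrite opprK lnK.
set s := - ln y in ys.
have sl : 0 <= s by move: y1; rewrite ys expR_le1; lra.
have sr : s <= s0 by move: y0; rewrite ys ler_expR; lra.
have s1 : 0 <= s <= 1 by apply/andP; split; lra.
have vE : u / y = u * expR s by rewrite ys expRN invrK.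
have uv : u <= u / y by rewrite ler_pdivlMr// ler_piMr// ltW.
have uM1 : M1 < u by near: u; apply: nbhs_pinfty_gt; exact: num_real.
have [hl hu] := H1 _ (lt_le_trans uM1 uv).
set v := u / y in vE uv hl hu *.
pose q := ln (a u) - ln (a v) + s.
have qr : `|q| <= r.
  have hq : `|ln (a (u * expR s)) - ln (a u) + tau * s| < r / 2.
    by move: s s1 {q ys sl sr vE}; near: u; exact: gumbel_scale_uniform.
  rewrite -vE in hq.
  have -> : q = - (ln (a v) - ln (a u) + tau * s) + (1 + tau) * s.
    by rewrite /q; ring.
  apply: le_trans (ler_normD _ _) _; rewrite normrN normrM (ger0_norm sl).
  have : `|1 + tau| * s <= (1 + `|tau|) * s0.
    by apply: ler_pM => //; rewrite -{2}[1]normr1 ler_normD.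
  have -> : (1 + `|tau|) * s0 = r / 2.
    have -> : 1 + `|tau| = K / 2 by rewrite /K; field.
    by rewrite /s0; field; rewrite gt_eqF//; lra.
  lra.
have -> : (u + a u * t) / y = v + a v * (t * expR q).
  rewrite mulrDl -/v; congr (_ + _).
  rewrite /q expRD expRB !lnK ?posrE// ys expRN invrK; field.
  by rewrite gt_eqF.
move: qr; rewrite ler_norml => /andP[q1 q2].
apply/andP; split.
  apply: le_trans (ltW hl) _; apply: F_noninc; rewrite lerD2l ler_pM2l//.
  by rewrite ler_wpM2l// ler_expR.
apply: le_trans (ltW hu); apply: F_noninc; rewrite lerD2l ler_pM2l//.
by rewrite ler_wpM2l// ler_expR.
Unshelve. all: by end_near. Qed.

End gumbel_tail.

(** * Products of independent variables *)

Section independent_pair.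
Context {d} {T : measurableType d} {R : realType} (P : probability T R).
Variables Y1 Y2 : {RV P >-> R}.
Hypothesis indepY : indep2 P Y1 Y2.
Local Open Scope ereal_scope.

(** Independence identifies the joint law with the product measure on rectangles, hence everywhere.
    A second appeal to uniqueness exchanges the order of integration. *)
Lemma indep2_integral_ysection (A : set (R * R)) : measurable A ->
  P [set w | A (Y1 w, Y2 w)] =
  \int[distribution P Y2]_y distribution P Y1 (ysection A y).
Proof.
move=> mA.
have mY : measurable_fun [set: T] (fun w => (Y1 w, Y2 w)).
  exact/measurable_fun_pair.
pose m1 := distribution P Y1; pose m2 := distribution P Y2.
have joint : (m1 \x m2) A =
    pushforward P (mfun_Sub (mem_set mY)) A.
  exact: product_measure_unique.
have section : (m1 \x m2) A = (m1 \x^ m2) A.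
  apply: product_measure_unique => // B C mB mC.
  exact: product_measure2E.
by rewrite -[LHS]/(pushforward P (mfun_Sub (mem_set mY)) A) -joint section.
Qed.

Lemma indep2_le (A B : set (R * R)) (k : R) :
  measurable A -> measurable B -> (0 <= k)%R ->
  (forall y, P (Y1 @^-1` ysection A y) <= k%:E * P (Y1 @^-1` ysection B y)) ->
  P [set w | A (Y1 w, Y2 w)] <= k%:E * P [set w | B (Y1 w, Y2 w)].
Proof.
move=> mA mB k0 AB; rewrite !indep2_integral_ysection//.
have mfA : measurable_fun [set: R] (fun y => distribution P Y1 (ysection A y)).
  exact: measurable_fun_ysection.
have mfB : measurable_fun [set: R] (fun y => distribution P Y1 (ysection B y)).
  exact: measurable_fun_ysection.
rewrite -ge0_integralZl_EFin//; apply: ge0_le_integral => //.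
  by apply: emeasurable_funM => //; exact: measurable_cst.
by move=> y _; exact: AB.
Qed.

End independent_pair.

(** * Tail of the product, split by the value of the bounded factor *)

Section product_tail.
Context {d} {T : measurableType d} {R : realType} (P : probability T R).
Implicit Types Y : {RV P >-> R}.

Lemma fine_prob_le (A B : set T) : measurable A -> measurable B ->
  A `<=` B -> fine (P A) <= fine (P B).
Proof.
by move=> mA mB AB; rewrite fine_le ?fin_num_measure// le_measure ?inE.
Qed.

Lemma measurable_RV_gt Y (u : R) : measurable [set w | u < Y w].
Proof.
rewrite -[X in measurable X]setTI.
have := measurable_funPT Y measurableT _ (measurable_itv `]u, +oo[).
by congr measurable; apply/seteqP; split => w /=; rewrite in_itv/= andbT.
Qed.

Lemma tailP_nonincreasing Y :
  {homo tailP P Y : x y / x <= y >-> y <= x}.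
Proof.
move=> x y xy; apply: fine_prob_le; try exact: measurable_RV_gt.
by move=> w /=; exact: le_lt_trans.
Qed.

Lemma tailP_cvg0 Y : tailP P Y x @[x --> +oo] --> (0 : R).
Proof.
rewrite (_ : tailP P Y = fine \o ccdf Y); first exact: fine_cvg (cvg_ccdfy0 Y).
apply/funext => u; rewrite /tailP /ccdf /=; congr (fine (P _)).
by apply/seteqP; split => w /=; rewrite in_itv/= andbT.
Qed.

Variables Y1 Y2 : {RV P >-> R}.
Hypothesis indepY : indep2 P Y1 Y2.

Definition prodtail (B : set R) (u : R) : R :=
  fine (P [set w | B (Y2 w) /\ u < Y1 w * Y2 w]).

Let region (B : set R) (u : R) : set (R * R) :=
  [set z | B z.2 /\ u < z.1 * z.2].

Let measurable_region B u : measurable B -> measurable (region B u).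
Proof.
move=> mB; apply: measurableI.
  by rewrite -[X in measurable X]setTI; apply: measurable_snd.
have m : measurable_fun [set: R * R] (fun z : R * R => z.1 * z.2).
  by apply: measurable_funM; [exact: measurable_fst|exact: measurable_snd].
rewrite -[X in measurable X]setTI.
have := m measurableT _ (measurable_itv `]u, +oo[).
by congr measurable; apply/seteqP; split => w /=; rewrite in_itv/= andbT.
Qed.

Lemma measurable_prodtail B u : measurable B ->
  measurable [set w | B (Y2 w) /\ u < Y1 w * Y2 w].
Proof.
move=> mB; have mY : measurable_fun [set: T] (fun w => (Y1 w, Y2 w)).
  exact/measurable_fun_pair.
rewrite -[X in measurable X]setTI.
exact: (mY measurableT _ (measurable_region B u mB)).
Qed.

(** Given [Y2 = y] in [B], the event is a tail of [Y1] at level [u / y]; outside [B] the sections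
    are empty. A constant valid for all [y] survives integration. *)
Lemma prodtail_le (B : set R) (u v k : R) : measurable B ->
  (forall y, B y -> 0 < y) -> 0 <= k ->
  (forall y, B y -> tailP P Y1 (v / y) <= k * tailP P Y1 (u / y)) ->
  prodtail B v <= k * prodtail B u.
Proof.
move=> mB B0 k0 Bk.
have sec w y : B y -> Y1 @^-1` ysection (region B w) y = [set x | w / y < Y1 x].
  move=> By; apply/seteqP; split => x /=.
    by move=> /ysectionP[_ /=]; rewrite ltr_pdivrMr ?B0.
  by move=> xw; apply/ysectionP; split => //=; rewrite -ltr_pdivrMr ?B0.
have sec0 w y : ~ B y -> Y1 @^-1` ysection (region B w) y = set0.
  by move=> By; rewrite -subset0 => x /= /ysectionP[].
have finP w : measurable [set x | B (Y2 x) /\ w < Y1 x * Y2 x] ->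
    P [set x | B (Y2 x) /\ w < Y1 x * Y2 x] = (prodtail B w)%:E.
  by move=> m; rewrite fineK ?fin_num_measure.
rewrite -lee_fin EFinM -!finP; try exact: measurable_prodtail.
apply: (indep2_le _ _ _ indepY (region B v) (region B u)) => //;
  try exact: measurable_region.
move=> y; have [By|nBy] := pselect (B y); last first.
  by rewrite !sec0// measure0 mule0.
rewrite !sec//; have := Bk _ By.
rewrite -lee_fin EFinM /tailP !fineK ?fin_num_measure//;
  exact: measurable_RV_gt.
Qed.

Hypothesis Y2_gt0 : P [set w | 0 < Y2 w] = 1%E.
Hypothesis Y2_end : right_endpoint P Y2 = 1%E.

Let F := tailP P Y1.
Let M := tailP P (fun w => Y1 w * Y2 w).

Lemma right_endpoint_tail_gt0 x : x < 1 -> 0 < tailP P Y2 x.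
Proof.
move=> x1; have : (x%:E < right_endpoint P Y2)%E by rewrite Y2_end lte_fin.
move=> /ereal_sup_gt[_ [y /= Py <-]]; rewrite lte_fin => xy.
apply: (@lt_le_trans _ _ (tailP P Y2 y)); last exact/tailP_nonincreasing/ltW.
rewrite fine_gt0// Py/= -ge0_fin_numE// fin_num_measure//.
exact: measurable_RV_gt.
Qed.

Lemma right_endpoint_tail0 : P [set w | 1 < Y2 w] = 0%E.
Proof.
have tail0 x : 1 < x -> P [set w | x < Y2 w] = 0%E.
  move=> x1; apply/eqP; rewrite eq_le measure_ge0 andbT leNgt; apply/negP => Px.
  have : (x%:E <= right_endpoint P Y2)%E by apply: ereal_sup_ubound; exists x.
  by rewrite Y2_end lee_fin leNgt x1.
have -> : [set w | 1 < Y2 w] = \bigcup_n [set w | 1 + n.+1%:R^-1 < Y2 w].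
  apply/seteqP; split => [w /= Yw|w [n _ /=]].
    exists (Num.truncn (Y2 w - 1)^-1) => //=.
    rewrite -ltrBrDl invf_plt ?posrE ?subr_gt0//; exact: truncnS_gt.
  by apply: lt_trans; rewrite ltrDl.
apply: measure_negligible.
  by apply: bigcupT_measurable => n; exact: measurable_RV_gt.
apply: negligible_bigcup => n; apply/negligibleP; first exact: measurable_RV_gt.
by apply: tail0; rewrite ltrDl invr_gt0.
Qed.

(** The two pieces miss only outcomes with [Y2 <= 0] or [Y2 > 1], which form a null set. *)
Lemma tailP_mul_split (c u : R) : 0 < c < 1 ->
  M u = prodtail `]0, c]%classic u + prodtail `]c, 1]%classic u.
Proof.
move=> /andP[c0 c1].
have mX : measurable [set w | u < Y1 w * Y2 w].
  rewrite (_ : [set w | _] = [set w | [set: R] (Y2 w) /\ u < Y1 w * Y2 w]).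
    exact: measurable_prodtail.
  by apply/seteqP; split => w //= [].
have m1 := measurable_prodtail `]0, c]%classic u (measurable_itv _).
have m2 := measurable_prodtail `]c, 1]%classic u (measurable_itv _).
rewrite /prodtail -fineD ?fin_num_measure// -measureU//; last first.
  rewrite -subset0 => w [[/= + _] [+ _]].
  rewrite !in_itv/= => /andP[_ a] /andP[b _].
  by have := le_lt_trans a b; rewrite ltxx.
set W := (X in _ = fine (P X)).
have mW : measurable W by exact: measurableU.
have m0 := measurable_RV_gt Y2 0; have m1' := measurable_RV_gt Y2 1.
have mN : measurable (~` [set w | 0 < Y2 w] `|` [set w | 1 < Y2 w]).
  by apply: measurableU => //; exact: measurableC.
have N0 : P (~` [set w | 0 < Y2 w] `|` [set w | 1 < Y2 w]) = 0%E.
  apply: (etrans (measureU0 (measurableC m0) m1' right_endpoint_tail0)).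
  by rewrite [LHS]probability_setC// Y2_gt0 subee.
congr fine; apply/eqP; rewrite eq_le; apply/andP; split.
  rewrite -(measureU0 mW mN N0) le_measure ?inE//; first exact: measurableU.
  move=> w /= uw; have [Y0|Y0] := ltP 0 (Y2 w); last first.
    by right; left.
  have [Y1'|Y1'] := ltP 1 (Y2 w); first by right; right.
  left; have [Yc|Yc] := leP (Y2 w) c; [left|right];
  by rewrite /= in_itv/= ?Y0 ?Yc ?Y1'.
by rewrite le_measure ?inE// => w [] [].
Qed.

Lemma prodtail_low_le (c u : R) : 0 < c -> 0 <= u ->
  prodtail `]0, c]%classic u <= F (u / c).
Proof.
move=> c0 u0; apply: fine_prob_le.
- exact: measurable_prodtail.
- exact: measurable_RV_gt.
move=> w /= [+ uY]; rewrite in_itv/= => /andP[Y0 Yc].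
rewrite ltr_pdivrMr//; apply: (lt_le_trans uY).
(* Replacing [Y2 w] by [c] needs [Y1 w >= 0], which follows from [0 <= u < Y1 w * Y2 w] and
   [Y2 w > 0]. *)
by rewrite ler_wpM2l// -(pmulr_lge0 _ Y0) (le_trans u0)// ltW.
Qed.

Lemma tailP_mul_ge (c u : R) : 0 < c -> 0 <= u ->
  F (u / c) * tailP P Y2 c <= M u.
Proof.
move=> c0 u0.
have mX : measurable [set w | u < Y1 w * Y2 w].
  rewrite (_ : [set w | _] = [set w | [set: R] (Y2 w) /\ u < Y1 w * Y2 w]).
    exact: measurable_prodtail.
  by apply/seteqP; split => w //= [].
have pre Y x : Y @^-1` `]x, +oo[%classic = [set w | x < Y w].
  by apply/seteqP; split => w /=; rewrite in_itv/= andbT.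
have := indepY `]u / c, +oo[%classic `]c, +oo[%classic
  (measurable_itv _) (measurable_itv _).
rewrite !pre => PI.
rewrite /F /tailP -fineM ?fin_num_measure//; try exact: measurable_RV_gt.
rewrite -PI; apply: fine_prob_le => //.
  by apply: measurableI; exact: measurable_RV_gt.
move=> w [/= uY cY].
have Y10 : 0 < Y1 w by apply: le_lt_trans uY; rewrite divr_ge0// ltW.
rewrite ltr_pdivrMr// in uY.
by apply: lt_trans uY _; rewrite ltr_pM2l.
Qed.

End product_tail.

(** * The tail ratio of the product *)

Theorem theorem1p1 (d : measure_display) (T : measurableType d) (R : realType)
  (P : probability T R) (Y1 Y2 : {RV P >-> R}) (a : R -> R) (tau : R) :
  indep2 P Y1 Y2 ->
  P [set w | 0 < Y1 w] = 1%E ->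
  P [set w | 0 < Y2 w] = 1%E ->
  (forall u : R, (0 < P [set w | (u < Y1 w)%R])%E) ->
  (forall u : R, 0 < a u) ->
  -1 <= tau ->
  (forall x : R, 0 < x -> (a (u * x) / a u) @[u --> +oo] --> x `^ (- tau)) ->
  gumbel_mda P Y1 a ->
  right_endpoint P Y2 = 1%E ->
  gumbel_mda P (fun w => Y1 w * Y2 w) a.
Proof.
move=> indepY _ Y2_gt0 Y1_tail a_gt0 _ a_rv gumbelY1 Y2_end t t0.
set X := fun w => Y1 w * Y2 w.
pose F := tailP P Y1.
have F_gt0 u : 0 < F u.
  rewrite fine_gt0// Y1_tail/= -ge0_fin_numE//.
  by rewrite fin_num_measure//; exact: measurable_RV_gt.
have F_ni : {homo F : x y / x <= y >-> y <= x} := tailP_nonincreasing P Y1.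
have F_cvg0 : F x @[x --> +oo] --> (0 : R) := tailP_cvg0 P Y1.
have et1 : expR (- t) <= 1 by rewrite expR_le1 oppr_le0.
have et0 := expR_gt0 (- t).
apply/cvgrPdist_le => e0 e0_gt0.
(* The final error is [2 * e]; the second bound keeps [expR (- t) - e] positive, so that it can be
   inverted. *)
pose e := Num.min (e0 / 2) (expR (- t) / 2).
have e_gt0 : 0 < e by rewrite lt_min !divr_gt0.
have e_e0 : 2 * e <= e0.
  have : e <= e0 / 2 by rewrite ge_min lexx.
  lra.
have e_et : e < expR (- t).
  have : e <= expR (- t) / 2 by rewrite ge_min lexx orbT.
  lra.
have [dl /andP[dl0 dl1] unif] := gumbel_uniform _ _ F_ni F_gt0 F_cvg0 a_gt0
  gumbelY1 _ a_rv _ _ t0 e_gt0.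
(* Two cutoffs are needed: the low part is at most [F (u / c)], the whole tail at least
   [F (u / c') * p], and [c' / c > 1] lets rapid variation make the former negligible. *)
pose c := 1 - dl; pose c' := 1 - dl / 2.
have c0 : 0 < c by rewrite subr_gt0.
have c'0 : 0 < c' by rewrite /c'; lra.
have cc' : c < c' by rewrite /c /c'; lra.
have c01 : 0 < c < 1 by rewrite c0 /c; lra.
have p_gt0 : 0 < tailP P Y2 c'.
  by apply: right_endpoint_tail_gt0 => //; rewrite /c'; lra.
set p := tailP P Y2 c' in p_gt0.
have l1 : 1 < c' / c by rewrite ltr_pdivlMr ?mul1r.
have [K [_ rapid]] := gumbel_rapid _ _ F_ni F_gt0 F_cvg0 a_gt0 gumbelY1 _ _ l1
  (mulr_gt0 e_gt0 p_gt0).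
near=> u.
have u0 : 0 < u by [].
have unifu : forall y, 1 - dl <= y <= 1 ->
    (expR (- t) - e) * F (u / y) <= F ((u + a u * t) / y) <=
    (expR (- t) + e) * F (u / y) by near: u.
pose v := u + a u * t.
have uv : u <= v by rewrite lerDl mulr_ge0// ltW.
have v0 : 0 <= v by apply: le_trans uv; exact: ltW.
pose low := prodtail P Y1 Y2 `]0, c]%classic.
pose high := prodtail P Y1 Y2 `]c, 1]%classic.
have splitX w : tailP P X w = low w + high w.
  exact: tailP_mul_split.
have low_ge0 w : 0 <= low w by rewrite fine_ge0.
have high_ge0 w : 0 <= high w by rewrite fine_ge0.
have X_ge : F (u / c') * p <= tailP P X u.
  by apply: tailP_mul_ge => //; exact: ltW.
have X_gt0 : 0 < tailP P X u by apply: lt_le_trans X_ge; rewrite mulr_gt0.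
have low_small : low u <= e * tailP P X u.
  apply: le_trans (prodtail_low_le _ _ _ _ _ c0 (ltW u0)) _.
  have Ku : K < u / c'.
    have uc' : u <= u / c'.
      by rewrite ler_pdivlMr// ler_piMr ?(ltW u0)// /c'; lra.
    by apply: lt_le_trans uc'; near: u; apply: nbhs_pinfty_gt; exact: num_real.
  have := rapid _ Ku.
  have -> : u / c' * (c' / c) = u / c by field; rewrite !gt_eqF.
  move=> /le_trans; apply.
  by rewrite -mulrA ler_pM2l// mulrC.
have low_ni : low v <= low u.
  apply: fine_prob_le; try exact: measurable_prodtail.
  by move=> w /= [Yw vw]; split => //; exact: le_lt_trans vw.
have B0 y : `]c, 1]%classic y -> 0 < y.
  by rewrite /= in_itv/= => /andP[cy _]; exact: lt_trans cy.
have By y : `]c, 1]%classic y -> 1 - dl <= y <= 1.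
  by rewrite /= in_itv/= => /andP[cy ->]; rewrite (ltW cy).
have high_le : high v <= (expR (- t) + e) * high u.
  apply: prodtail_le => //; first by rewrite addr_ge0// ltW.
  by move=> y /By/unifu/andP[].
have k0 : 0 < expR (- t) - e by rewrite subr_gt0.
(* The same comparison lemma applies with [u] and [v] exchanged and the inverse constant. *)
have high_ge : (expR (- t) - e) * high u <= high v.
  rewrite -ler_pdivlMl//.
  apply: prodtail_le => //; first by rewrite invr_ge0 ltW.
  move=> y /By/unifu/andP[h _].
  by rewrite ler_pdivlMl.
move: X_gt0 low_small; rewrite -/v !splitX => X_gt0 low_small.
have lu := low_ge0 u; have lv := low_ge0 v; have hu := high_ge0 u.
(* Below, dropping [low v] and losing [low u] costs at most [e] times the tail at [u], on top of the
   error [e] on the high part. Above, [low v <= low u] adds at most the same amount. *)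
rewrite distrC ler_norml; apply/andP; split.
  rewrite lerBrDr ler_pdivlMr//.
  have : (expR (- t) - e) * low u <= e * (low u + high u).
    by apply: le_trans low_small; rewrite ler_piMl//; lra.
  nra.
rewrite lerBlDr ler_pdivrMr//.
nra.
Unshelve. all: by end_near. Qed.
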